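(* Let $n\ge1$, $d\ge0$. Every sorted recurrent configuration on $S_{n,d}$ is toppling-and-permuting equivalent to exactly $n+1$ of the $\binom{2n+d}{n}\binom{n+d}{n}$ sorted quasi-stable non-negative configurations on $S_{n,d}$ (including itself, but no other sorted recurrent configuration).
   Context: The complete split graph $S_{n,d}$ has a sink $s$, clique vertices $K=\{v_1,\ldots,v_n\}$ (indexed $0,\ldots,n-1$) and independent vertices $I=\{w_1,\ldots,w_d\}$ (indexed $0,\ldots,d-1$); any two distinct vertices among $s,v_1,\ldots,v_n$ are adjacent, each $w_j$ is adjacent to each of $s,v_1,\ldots,v_n$, no two $w_j$'s are adjacent. So $\deg(v)=n+d$ for $v\in K\cup\{s\}$ and $\deg(w)=n+1$ for $w\in I$. Here a configuration is any $u=(u^{[K]};u^{[I]})\in\mathbb{Z}^n\times\mathbb{Z}^d$ (entries may be negative), the sink carrying $u_s=-(\sum_k u^{[K]}_k+\sum_i u^{[I]}_i)$. For any vertex $v$ (including $s$), $\Delta^{(v)}$ is the toppling vector: adding it removes $\deg(v)$ grains from $v$ and adds one grain to each neighbour of $v$. A permutation $\sigma^{[C]}$ of a component $C\in\{K,I\}$ acts by $(\sigma^{[C]}.u^{[C]})_c=u^{[C]}_{\sigma^{[C]}(c)}$. Two configurations $u,u'$ are toppling-and-permuting equivalent if $u'=(\sigma^{[K]},\sigma^{[I]}).u+\sum_{v}a_v\Delta^{(v)}$ for some permutations $\sigma^{[K]}$ of $K$, $\sigma^{[I]}$ of $I$, and integers $(a_v)$ indexed by all vertices including $s$. A configuration is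 sorted if $u^{[K]}$ and $u^{[I]}$ are weakly decreasing sequences, non-negative if all its (non-sink) entries are $\ge0$, and quasi-stable if $\max_k u^{[K]}_k\le n+d$ and $\max_i u^{[I]}_i\le n$. A non-negative configuration is stable if each non-sink vertex has fewer grains than its degree; a stable configuration $c$ is recurrent iff there is an ordering $s=u_0,\ldots,u_{n+d}$ of all vertices such that from $c$, toppling $u_0,\ldots,u_{i-1}$ in turn makes $u_i$ unstable (number of grains $\ge$ degree) for each $i\ge1$. *)

(* Defs.v *)
From mathcomp Require Import all_boot all_order all_fingroup all_algebra.
From mathcomp Require Import classical_sets cardinality.

Set Implicit Arguments.
Unset Strict Implicit.
Unset Printing Implicit Defensive.

Import Order.TTheory GRing.Theory Num.Theory.
Local Open Scope ring_scope.

(* [None] is the sink, [Some (inl k)] a clique vertex and [Some (inr i)] an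
   independent vertex. *)
Definition vertex (n d : nat) : Type := option ('I_n + 'I_d).

Definition sink (n d : nat) : vertex n d := None.
Definition clique (n d : nat) (k : 'I_n) : vertex n d := Some (inl k).
Definition indep (n d : nat) (i : 'I_d) : vertex n d := Some (inr i).

Definition is_indep (n d : nat) (v : vertex n d) : bool :=
  if v is Some (inr _) then true else false.

Definition adj (n d : nat) : rel (vertex n d) :=
  fun v w => (v != w) && ~~ (is_indep v && is_indep w).

Definition deg (n d : nat) (v : vertex n d) : nat := #|[pred w | adj v w]|.

Definition config (n d : nat) : Type :=
  ({ffun 'I_n -> int} * {ffun 'I_d -> int})%type.

Definition grains (n d : nat) (u : config n d) (v : vertex n d) : int :=
  match v with
  | None => - (\sum_k u.1 k + \sum_i u.2 i)
  | Some (inl k) => u.1 k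
  | Some (inr i) => u.2 i
  end.

Definition topple_entry (n d : nat) (v w : vertex n d) : int :=
  if w == v then - (deg v)%:Z else (adj v w)%:Z.

(* Only the non-sink entries are stored; the sink entry is recovered by
   [grains], see [grains_toppling]. *)
Definition toppling (n d : nat) (v : vertex n d) : config n d :=
  ([ffun k => topple_entry v (clique d k)],
   [ffun i => topple_entry v (indep n i)]).

Definition perm_config (n d : nat) (sK : {perm 'I_n}) (sI : {perm 'I_d})
    (u : config n d) : config n d :=
  ([ffun k => u.1 (sK k)], [ffun i => u.2 (sI i)]).

Definition toppling_perm_equiv (n d : nat) (u u' : config n d) : Prop :=
  exists (sK : {perm 'I_n}) (sI : {perm 'I_d}) (a : vertex n d -> int),
    u' = perm_config sK sI u + \sum_v toppling v *~ a v.

Definition sorted_config (n d : nat) (u : config n d) : Prop :=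
  (forall k l : 'I_n, (k <= l)%N -> u.1 l <= u.1 k) /\
  (forall i j : 'I_d, (i <= j)%N -> u.2 j <= u.2 i).

Definition nonneg (n d : nat) (u : config n d) : Prop :=
  (forall k, 0 <= u.1 k) /\ (forall i, 0 <= u.2 i).

Definition quasi_stable (n d : nat) (u : config n d) : Prop :=
  (forall k, u.1 k <= (n + d)%N%:Z) /\ (forall i, u.2 i <= n%:Z).

Definition unstable_at (n d : nat) (u : config n d) (v : vertex n d) : Prop :=
  (deg v)%:Z <= grains u v.

Definition stable (n d : nat) (u : config n d) : Prop :=
  nonneg u /\ forall v, v != sink n d -> grains u v < (deg v)%:Z.

Definition recurrent (n d : nat) (c : config n d) : Prop :=
  stable c /\
  exists f : 'I_(n + d).+1 -> vertex n d,
    [/\ bijective f, f ord0 = sink n d &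
        forall i : 'I_(n + d).+1, (0 < i)%N ->
          unstable_at (c + \sum_(j < (n + d).+1 | (j < i)%N) toppling (f j))
                      (f i)].

Definition sorted_qs_nonneg (n d : nat) : set (config n d) :=
  fun u => [/\ sorted_config u, quasi_stable u & nonneg u].

Definition sorted_recurrent (n d : nat) : set (config n d) :=
  fun u => sorted_config u /\ recurrent u.

Arguments sorted_qs_nonneg : clear implicits.
Arguments sorted_recurrent : clear implicits.

Lemma deg_sum (n d : nat) (v : vertex n d) :
  (deg v)%:Z = \sum_(w | w != v) (adj v w)%:Z.
Proof.
rewrite /deg -(big_morph Posz PoszD (erefl _)) -sum1_card; congr Posz.
rewrite big_mkcond [RHS]big_mkcond; apply: eq_bigr => w _.
by rewrite inE /adj [v == w]eq_sym; do 2 case: (~~ _).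
Qed.

Lemma sum_vertex (n d : nat) (F : vertex n d -> int) :
  \sum_v F v = F (sink n d) + (\sum_k F (clique d k) + \sum_i F (indep n i)).
Proof.
rewrite (bigD1 (sink n d)) //=; congr (_ + _).
rewrite -(big_sumType _ xpredT (fun x => F (Some x))) /=.
rewrite (reindex_omap (fun x => Some x) id) => [|[x|]] //=.
by apply: eq_bigl => x; rewrite !eqxx.
Qed.

Lemma grains_toppling (n d : nat) (v w : vertex n d) :
  grains (toppling v) w = topple_entry v w.
Proof.
case: w => [[k|i]|]; rewrite /= ?ffunE //.
under eq_bigr do rewrite ffunE; under [X in _ + X]eq_bigr do rewrite ffunE.
have S0 : \sum_w topple_entry v w = 0.
  rewrite (bigD1 v) //= {1}/topple_entry eqxx deg_sum.
  rewrite [X in _ + X](eq_bigr (fun w => (adj v w)%:Z)) ?addNr // => w.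
  by rewrite /topple_entry => /negbTE ->.
by apply/esym/eqP; rewrite -addr_eq0 -sum_vertex S0.
Qed.

Lemma degE (n d : nat) (v : vertex n d) :
  deg v = (if is_indep v then n.+1 else n + d)%N.
Proof.
have degs : (deg v)%:Z = \sum_w (adj v w)%:Z.
  by rewrite deg_sum [RHS](bigD1 v) //= /adj eqxx add0r.
have sumC (I : finType) : \sum_(i : I) 1%N%:Z = #|I|%:Z.
  by rewrite -(big_morph Posz PoszD (erefl _)) sum1_card.
have sumD (I : finType) (j : I) : \sum_i (j != i)%:Z = #|I|.-1%:Z.
  rewrite (bigD1 j) //= eqxx add0r -(big_morph Posz PoszD (erefl _)).
  rewrite -(cardC1 j) -sum1_card; congr Posz; apply: eq_big => i; rewrite ?inE //.
  by rewrite eq_sym => ->.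
apply/eqP; rewrite -eqz_nat degs sum_vertex; case: v {degs} => [[k|j]|] /=.
- rewrite (eq_bigr (fun i => (k != i)%:Z)) => [|i _]; last by rewrite /adj /= andbT.
  rewrite sumD sumC !card_ord -!PoszD eqz_nat.
  by case: n k => [[]|n] //.
- by rewrite sumC [X in _ + (_ + X)]big1 ?card_ord ?addr0 // => i _; rewrite /adj andbF.
- by rewrite !sumC !card_ord.
Qed.

(* Main.v *)
(* Put N = n + d + 1 and M = n + 1. Up to permutations, a combination of toppling
   vectors shifts all clique entries by an integer p modulo N and all independent
   entries by an integer q modulo M, and quasi-stable non-negative configurations
   are exactly the reduced ones. Counting topplings, the reduced shift of c by
   (p, q) is equivalent to c iff F p = q and G q = p - q, where F and G sum the
   quotients of the shifted entries of c by N and M. Eliminating p leaves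
   D q := q - F (q + G q) = 0; since D (q + M) = D q + 1, there is exactly one
   solution q in each residue class modulo M. The n + 1 solutions give distinct
   configurations because the total number of grains determines p, hence q.

   For two equivalent recurrent configurations, Dhar's burning criterion shows
   that the toppling coefficient of the sink is both minimal and maximal, so that
   all coefficients coincide and only permutations remain. *)
From HB Require Import structures.
Require Import Defs.
From mathcomp Require Import all_boot all_order all_algebra.
From mathcomp Require Import perm zify ring.
From mathcomp Require Import classical_sets cardinality.

Set Implicit Arguments.
Unset Strict Implicit.
Unset Printing Implicit Defensive.

Import Order.TTheory GRing.Theory Num.Theory.

Local Open Scope classical_set_scope.
Local Open Scope card_scope.
Local Open Scope ring_scope.

(** * Finite ranges and decreasing rearrangements *)

Lemma card_eq_range (T : finType) U (f : T -> U) (A : set U) k :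
  #|T| = k -> injective f -> (forall x, A (f x)) ->
  (forall y, A y -> exists x, f x = y) -> A #= `I_k.
Proof.
move=> <- injf fA Af.
have injg : injective (fun i : 'I_#|T| => f (enum_val i)).
  exact: inj_comp injf enum_val_inj.
suff -> : A = (fun i : 'I_#|T| => f (enum_val i)) @` setT.
  apply: (@card_eq_trans _ _ _ _ [set: 'I_#|T|]).
    by apply: inj_card_eq => i j _ _; exact: injg.
  by rewrite card_eq_sym card_II.
apply/seteqP; split=> [y /Af [x <-]|_ [i _ <-]]; last exact: fA.
by exists (enum_rank x); rewrite // enum_rankK.
Qed.

Definition decreasing m (f : 'I_m -> int) :=
  forall i j : 'I_m, (i <= j)%N -> f j <= f i.

Lemma decreasing_sorted m (f : 'I_m -> int) :
  decreasing f -> sorted >=%R (map f (enum 'I_m)).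
Proof.
move=> decf; rewrite sorted_map.
apply: (@sub_sorted _ (relpre val leq)) => [i j /decf //|].
by rewrite -sorted_map val_enum_ord iota_sorted.
Qed.

Lemma decreasing_perm_eq m (f g : 'I_m -> int) (s : {perm 'I_m}) :
  decreasing f -> decreasing g -> (forall i, g i = f (s i)) -> f =1 g.
Proof.
move=> decf decg gE.
have geT : transitive (>=%R : rel int) by move=> x y z yx zy; exact: le_trans zy yx.
have geA : antisymmetric (>=%R : rel int) by move=> x y; rewrite andbC => /le_anti.
have eqs : map f (enum 'I_m) = map g (enum 'I_m).
  apply: (sorted_eq geT geA); [exact: decreasing_sorted..|].
  rewrite (eq_map gE) (map_comp f s) perm_map // uniq_perm ?enum_uniq //.
    by rewrite map_inj_uniq ?enum_uniq //; exact: perm_inj.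
  move=> i; rewrite mem_enum; apply/esym/mapP.
  by exists (s^-1%g i); rewrite ?mem_enum // permKV.
by move=> i; move/eq_in_map: eqs; apply; rewrite mem_enum.
Qed.

Definition decreasing_sort m (f : 'I_m -> int) : {ffun 'I_m -> int} :=
  [ffun i : 'I_m => nth 0 (sort >=%R [tuple f i | i < m]) i].

Lemma decreasing_sort_perm m (f : 'I_m -> int) :
  exists s : {perm 'I_m}, forall i, decreasing_sort f i = f (s i).
Proof.
have /tuple_permP[s Es] : perm_eq (sort >=%R [tuple f i | i < m]) [tuple f i | i < m].
  by rewrite perm_sort.
by exists s => i; rewrite ffunE Es -tnth_nth !tnth_mktuple.
Qed.

Lemma decreasing_sortP m (f : 'I_m -> int) : decreasing (decreasing_sort f).
Proof.
move=> i j le_ij; rewrite !ffunE.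
have szs : size (sort >=%R [tuple f i | i < m]) = m by rewrite size_sort size_tuple.
have geT : transitive (>=%R : rel int) by move=> x y z yx zy; exact: le_trans zy yx.
have geTot : total (>=%R : rel int) by move=> x y; rewrite /= le_total.
apply: (sorted_leq_nth geT (@lexx _ _) _ (sort_sorted geTot _)) => //; rewrite ?inE ?szs //.
Qed.

(** * Counting sorted quasi-stable non-negative configurations *)

(** The tuple is read backwards because [card_sorted_tuples] counts weakly increasing tuples. *)
Definition decreasing_of_tuple m N (t : m.-tuple 'I_N.+1) : {ffun 'I_m -> int} :=
  [ffun i => (tnth t (rev_ord i))%:Z].

Lemma decreasing_of_tuple_inj m N : injective (@decreasing_of_tuple m N).
Proof.
move=> t1 t2 /ffunP eq_t; apply: eq_from_tnth => i.
have := eq_t (rev_ord i); rewrite !ffunE rev_ordK => -[] eq_i.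
exact: val_inj.
Qed.

Lemma decreasing_of_tupleP m N (t : m.-tuple 'I_N.+1) :
  sorted leq (map val t) -> decreasing (decreasing_of_tuple t).
Proof.
move=> st i j le_ij; rewrite !ffunE lez_nat !(tnth_nth ord0).
have := sorted_leq_nth leq_trans leqnn 0%N st.
move=> /(_ (rev_ord j) (rev_ord i)); rewrite !inE size_map size_tuple !ltn_ord.
rewrite !(nth_map ord0) ?size_tuple ?ltn_ord //; apply=> //.
by rewrite /= leq_sub2l.
Qed.

Lemma decreasing_of_tuple_surj m N (f : {ffun 'I_m -> int}) :
  decreasing f -> (forall i, 0 <= f i) -> (forall i, f i <= N%:Z) ->
  exists2 t : m.-tuple 'I_N.+1, sorted leq (map val t) & decreasing_of_tuple t = f.
Proof.
move=> decf f0 fN.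
pose t := [tuple (inord (absz (f (rev_ord i))) : 'I_N.+1) | i < m].
have tE i : tnth t i = absz (f (rev_ord i)) :> nat.
  rewrite tnth_mktuple inordK //; have := f0 (rev_ord i); have := fN (rev_ord i); lia.
exists t; last first.
  by apply/ffunP => i; rewrite ffunE tE rev_ordK gez0_abs.
rewrite -[map _ t]/(map val (tval t)) sorted_map /t /=.
rewrite /image_mem sorted_map.
apply: (@sub_sorted _ (relpre val leq)) => [i j /= le_ij|].
  rewrite -[inord _ : nat]/(nat_of_ord _).
  have := tE i; have := tE j; rewrite !tnth_mktuple => -> ->.
  have := decf (rev_ord j) (rev_ord i); rewrite /= leq_sub2l //.
  by move=> /(_ isT); have := f0 (rev_ord i); have := f0 (rev_ord j); lia.
by rewrite -sorted_map val_enum_ord iota_sorted.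
Qed.

(** The two components are independent multisets: [n] values among [n + d + 1], and [d] values among
    [n + 1]; the second count is 'C(n + d, d) = 'C(n + d, n). *)
Lemma card_sorted_qs_nonneg n d :
  sorted_qs_nonneg n d #= `I_('C(2 * n + d, n) * 'C(n + d, n)).
Proof.
pose sT m N := {t : m.-tuple 'I_N.+1 | sorted leq (map val t)}.
apply: (@card_eq_range (sT n (n + d)%N * sT d n)%type _
  (fun t => (decreasing_of_tuple (val t.1), decreasing_of_tuple (val t.2)))).
- have card_sT m N : #|{: sT m N}| = 'C(m + N, m).
    rewrite card_sig -card_sorted_tuples; apply: eq_card => t.
    by rewrite [in RHS]inE.
  rewrite card_prod !card_sT addnA addnn -mul2n (addnC d).
  by rewrite -(bin_sub (leq_addl n d)) addnK.
- move=> [t1 t2] [u1 u2] [/decreasing_of_tuple_inj /val_inj ->].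
  by move=> /decreasing_of_tuple_inj /val_inj ->.
- move=> [[t1 s1] [t2 s2]]; split; split=> /=; try exact: decreasing_of_tupleP;
    move=> i; rewrite ffunE ?lez_nat //; by rewrite -ltnS.
- move=> [f g] [[/= df dg] [/= fN gN] [/= f0 g0]].
  have [t1 s1 <-] := decreasing_of_tuple_surj df f0 fN.
  have [t2 s2 <-] := decreasing_of_tuple_surj dg g0 gN.
  by exists (exist _ t1 s1, exist _ t2 s2).
Qed.

(** * Combinations of topplings as Laplacians *)

(** [grains] with the vertex first, so that at a fixed vertex it is an additive morphism that passes
    through sums of topplings. *)
Definition grains_at n d (v : vertex n d) (u : config n d) : int := grains u v.

Lemma grains_at_is_zmod_morphism n d (v : vertex n d) : zmod_morphism (grains_at v).
Proof.
move=> u w; rewrite /grains_at /grains.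
have -> : (u - w).1 = u.1 - w.1 by [].
have -> : (u - w).2 = u.2 - w.2 by [].
case: v => [[k|i]|]; rewrite ?ffunE //.
under eq_bigr do rewrite !ffunE; under [X in _ + X]eq_bigr do rewrite !ffunE.
by rewrite !sumrB; ring.
Qed.

HB.instance Definition _ n d (v : vertex n d) :=
  GRing.isZmodMorphism.Build (config n d) int (grains_at v)
    (grains_at_is_zmod_morphism v).

Lemma config_eq n d (u u' : config n d) :
  (forall k, u.1 k = u'.1 k) -> (forall i, u.2 i = u'.2 i) -> u = u'.
Proof.
by case: u u' => [f g] [f' g'] /= /ffunP-> /ffunP->.
Qed.

Lemma grains_toppling_sum n d (a : vertex n d -> int) w :
  grains (\sum_v toppling v *~ a v) w = \sum_v topple_entry v w * a v.
Proof.
rewrite -[LHS]/(grains_at w _) raddf_sum; apply: eq_bigr => v _.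
by rewrite -grains_toppling -mulrzz -[grains _ _]/(grains_at w _) raddfMz.
Qed.

Lemma grains_toppling_sum_adj n d (a : vertex n d -> int) w :
  grains (\sum_v toppling v *~ a v) w = \sum_v (adj w v)%:Z * (a v - a w).
Proof.
rewrite grains_toppling_sum (bigD1 w) //= [RHS](bigD1 w) //=.
rewrite subrr mulr0 add0r /topple_entry eqxx mulNr deg_sum mulr_suml addrC -sumrB.
apply: eq_bigr => v vw; rewrite eq_sym (negbTE vw).
by rewrite /adj eq_sym [is_indep v && _]andbC; ring.
Qed.

(** A clique vertex is adjacent to all others, so modulo [(n + d).+1] every clique entry receives
    the same shift. *)
Lemma grains_toppling_sum_clique n d (a : vertex n d -> int) k :
  grains (\sum_v toppling v *~ a v) (clique d k) =
  \sum_v a v - (n + d).+1%:Z * a (clique d k).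
Proof.
rewrite grains_toppling_sum_adj [\sum_v a v](bigD1 (clique d k)) //=.
rewrite (bigD1 (clique d k)) //=.
rewrite subrr mulr0 add0r.
under eq_bigr => v vk do rewrite /adj eq_sym vk mul1r.
rewrite sumrB.
have -> : \sum_(v | v != clique d k) a (clique d k) = (n + d)%:Z * a (clique d k).
  have <- : deg (clique d k) = (n + d)%N by rewrite degE.
  rewrite deg_sum mulr_suml.
  by apply: eq_bigr => v vk; rewrite /adj eq_sym vk mul1r.
by rewrite -[(n + d).+1]addn1 PoszD; ring.
Qed.

Lemma grains_toppling_sum_indep n d (a : vertex n d -> int) i :
  grains (\sum_v toppling v *~ a v) (indep n i) =
  a (sink n d) + \sum_k a (clique d k) - n.+1%:Z * a (indep n i).
Proof.
rewrite grains_toppling_sum_adj sum_vertex /adj /= mul1r.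
rewrite [X in _ + (_ + X)]big1 => [|j _]; last by rewrite andbF mul0r.
under eq_bigr do rewrite mul1r.
rewrite sumrB sumr_const card_ord -mulr_natl -[n.+1]addn1 PoszD natz; ring.
Qed.

Lemma toppling_perm_equivP n d (c u : config n d) :
  toppling_perm_equiv c u <->
  exists (sK : {perm 'I_n}) (sI : {perm 'I_d}) (a : vertex n d -> int),
    (forall k, u.1 k = c.1 (sK k) + \sum_v a v - (n + d).+1%:Z * a (clique d k)) /\
    (forall i, u.2 i = c.2 (sI i) + (a (sink n d) + \sum_k a (clique d k))
                       - n.+1%:Z * a (indep n i)).
Proof.
split=> -[sK [sI [a]]].
  move=> ->; exists sK, sI, a; split=> [k|i] /=; rewrite 2!ffunE /= -addrA.
    by congr (_ + _); rewrite -grains_toppling_sum_clique.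
  by congr (_ + _); rewrite -grains_toppling_sum_indep.
move=> [uK uI]; exists sK, sI, a; apply: config_eq => [k|i] /=;
  rewrite ?uK ?uI 2!ffunE /= -addrA; congr (_ + _).
  by rewrite -grains_toppling_sum_clique.
by rewrite -grains_toppling_sum_indep.
Qed.

(** * Reduced shifts and the equations for [p] and [q] *)

(** F is [quotient_sum (n + d).+1 c.1] and G is [quotient_sum n.+1 c.2]. *)
Definition quotient_sum m (N : nat) (f : 'I_m -> int) (p : int) : int :=
  \sum_i ((f i + p) %/ N%:Z)%Z.

Definition residue_shift m (N : nat) (f : 'I_m -> int) (p : int) (i : 'I_m) : int :=
  ((f i + p) %% N%:Z)%Z.

Lemma quotient_sumD m N (f : 'I_m -> int) (p t : int) :
  (0 < N)%N -> quotient_sum N f (p + N%:Z * t) = quotient_sum N f p + m%:Z * t.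
Proof.
move=> N0; rewrite /quotient_sum.
have -> : m%:Z * t = \sum_(i < m) t by rewrite sumr_const card_ord -mulr_natl natz.
rewrite -big_split; apply: eq_bigr => i _.
rewrite addrA [in LHS]addrC (mulrC N%:Z) divzMDl; last by lia.
exact: addrC.
Qed.

Lemma sum_residue_shift m N (f : 'I_m -> int) p :
  \sum_i residue_shift N f p i = \sum_i f i + m%:Z * p - N%:Z * quotient_sum N f p.
Proof.
rewrite /residue_shift /modz sumrB big_split /= sumr_const card_ord -mulr_natl natz.
by rewrite -mulr_suml [N%:Z * _]mulrC.
Qed.

Lemma divz_modzP (x y a N : int) :
  0 <= x < N -> x = y - N * a -> a = (y %/ N)%Z /\ x = (y %% N)%Z.
Proof.
move=> /andP[x0 xN] Ex.
have -> : y = a * N + x by rewrite Ex; ring.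
rewrite divzMDl ?modzMDl; last by lia.
have -> : (x %/ N)%Z = 0 by apply: divz_small; lia.
by rewrite modz_small ?x0 //; split; lia.
Qed.

(* [p] and [q] are the amounts added to all clique, resp. independent, vertices
   when the sink is not toppled; the equations express [p] and [q] through the
   numbers of topplings, which are the quotients since [u] is reduced. *)
Lemma toppling_perm_equiv_shiftP n d (c u : config n d) :
  quasi_stable u -> nonneg u ->
  toppling_perm_equiv c u <->
  exists p q : int,
    [/\ quotient_sum (n + d).+1 c.1 p = q,
        quotient_sum n.+1 c.2 q = p - q,
        exists s : {perm 'I_n}, forall k, u.1 k = residue_shift (n + d).+1 c.1 p (s k) &
        exists s : {perm 'I_d}, forall i, u.2 i = residue_shift n.+1 c.2 q (s i)].
Proof.
move=> [uN uM] [u0 u0']; rewrite toppling_perm_equivP; split.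
  move=> [sK [sI [a [uK uI]]]].
  set A := \sum_v a v in uK; set Q := _ + \sum_k _ in uI.
  (* Toppling every vertex once changes nothing, so [a s] may be subtracted from all coefficients;
     the sink then has coefficient 0. *)
  pose s := sink n d.
  have divK k := @divz_modzP (u.1 k) (c.1 (sK k) + (A - (n + d).+1%:Z * a s))
                   (a (clique d k) - a s) (n + d).+1%:Z.
  have divI i := @divz_modzP (u.2 i) (c.2 (sI i) + (Q - n.+1%:Z * a s))
                   (a (indep n i) - a s) n.+1%:Z.
  have {}divK k : a (clique d k) - a s =
       ((c.1 (sK k) + (A - (n + d).+1%:Z * a s)) %/ (n + d).+1%:Z)%Z /\
       u.1 k = residue_shift (n + d).+1 c.1 (A - (n + d).+1%:Z * a s) (sK k).
    by apply: divK; [have := uN k; have := u0 k; lia | rewrite uK; ring].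
  have {}divI i : a (indep n i) - a s =
       ((c.2 (sI i) + (Q - n.+1%:Z * a s)) %/ n.+1%:Z)%Z /\
       u.2 i = residue_shift n.+1 c.2 (Q - n.+1%:Z * a s) (sI i).
    by apply: divI; [have := uM i; have := u0' i; lia | rewrite uI; ring].
  exists (A - (n + d).+1%:Z * a s), (Q - n.+1%:Z * a s); split.
  - rewrite /quotient_sum (reindex_inj (@perm_inj _ sK)) /=.
    under eq_bigr do rewrite -(divK _).1.
    rewrite sumrB sumr_const card_ord -mulr_natl natz /Q -[n.+1]addn1 PoszD; ring.
  - rewrite /quotient_sum (reindex_inj (@perm_inj _ sI)) /=.
    under eq_bigr do rewrite -(divI _).1.
    rewrite sumrB sumr_const card_ord -mulr_natl natz /A /Q sum_vertex.
    rewrite -addSn -[n.+1]addn1 !PoszD; ring.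
  - by exists sK => k; exact: (divK k).2.
  - by exists sI => i; exact: (divI i).2.
move=> [p [q [Fp Gq [sK uK] [sI uI]]]].
pose a (v : vertex n d) : int := match v with
  | None => 0
  | Some (inl k) => ((c.1 (sK k) + p) %/ (n + d).+1%:Z)%Z
  | Some (inr i) => ((c.2 (sI i) + q) %/ n.+1%:Z)%Z
  end.
(* The two equations say exactly that the quotients, used as coefficients, produce the shifts [q]
   and [p] they were computed from. *)
have aK : \sum_k a (clique d k) = q.
  by rewrite -Fp /quotient_sum [RHS](reindex_inj (@perm_inj _ sK)).
have aI : \sum_i a (indep n i) = p - q.
  by rewrite -Gq /quotient_sum [RHS](reindex_inj (@perm_inj _ sI)).
exists sK, sI, a; split=> [k|i].
  by rewrite sum_vertex aK aI uK /residue_shift /modz /=; ring.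
by rewrite aK uI /residue_shift /modz /=; ring.
Qed.

(** * Enumeration of an equivalence class by residues modulo [n.+1] *)

(** The function D: here [p] is already replaced by q + G q. *)
Definition class_defect n d (c : config n d) (q : int) : int :=
  q - quotient_sum (n + d).+1 c.1 (q + quotient_sum n.+1 c.2 q).

(** Adding (n + 1) t to [q] adds d t to G q, hence (n + d + 1) t to [p] and n t to F p; the net
    change of D is (n + 1) t - n t = t. *)
Lemma class_defectD n d (c : config n d) q t :
  class_defect c (q + n.+1%:Z * t) = class_defect c q + t.
Proof.
rewrite /class_defect quotient_sumD //.
set G := quotient_sum n.+1 c.2 q.
have -> : q + n.+1%:Z * t + (G + d%:Z * t) = q + G + (n + d).+1%:Z * t.
  by rewrite -addSn PoszD; ring.
by rewrite quotient_sumD // -[n.+1]addn1 PoszD; ring.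
Qed.

(** The zero of D congruent to [r]: the multiple of [n.+1] cancels the defect at [r]. *)
Definition class_shift n d (c : config n d) (r : 'I_n.+1) : int :=
  r%:Z - n.+1%:Z * class_defect c r%:Z.

Lemma class_defect_shift n d (c : config n d) r : class_defect c (class_shift c r) = 0.
Proof. by rewrite /class_shift -mulrN class_defectD subrr. Qed.

Lemma class_shift_inj n d (c : config n d) : injective (class_shift c).
Proof.
move=> r r' eq_rr'; apply: val_inj.
have /= := congr1 (fun x => (x %% n.+1%:Z)%Z) eq_rr'.
rewrite /class_shift -!mulrN ![n.+1%:Z * _]mulrC ![_ + _ * n.+1%:Z]addrC !modzMDl.
by rewrite !modz_small ?ltz_nat ?ltn_ord // => -[].
Qed.

Lemma class_shift_surj n d (c : config n d) q :
  class_defect c q = 0 -> exists r, class_shift c r = q.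
Proof.
have r0 : 0 <= (q %% n.+1%:Z)%Z by rewrite modz_ge0.
have rM : (q %% n.+1%:Z)%Z < n.+1%:Z by rewrite ltz_pmod.
have Er : (absz (q %% n.+1%:Z)%Z)%:Z = (q %% n.+1%:Z)%Z by rewrite gez0_abs.
have rlt : (absz (q %% n.+1%:Z)%Z < n.+1)%N by rewrite -ltz_nat Er.
move=> q0; exists (Ordinal rlt); rewrite /class_shift /= Er.
(* With q = r + (n + 1) t, D q = 0 reads D r = - t, so the shift attached to [r] is [q] itself. *)
move: q0; rewrite {1}(divz_eq q n.+1%:Z) addrC mulrC class_defectD => /eqP.
rewrite addr_eq0 => /eqP ->.
by rewrite {3}(divz_eq q n.+1%:Z); ring.
Qed.

Definition class_config n d (c : config n d) (r : 'I_n.+1) : config n d :=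
  let q := class_shift c r in
  (decreasing_sort (residue_shift (n + d).+1 c.1 (q + quotient_sum n.+1 c.2 q)),
   decreasing_sort (residue_shift n.+1 c.2 q)).

Lemma decreasing_sort_sum m (f : 'I_m -> int) :
  \sum_i decreasing_sort f i = \sum_i f i.
Proof.
have [s fs] := decreasing_sort_perm f.
by rewrite [RHS](reindex_inj (@perm_inj _ s)); apply: eq_bigr => i _; exact: fs.
Qed.

Lemma class_config_qs n d (c : config n d) r : sorted_qs_nonneg n d (class_config c r).
Proof.
split; split=> /=; try exact: decreasing_sortP.
- move=> k; have [s ->] := decreasing_sort_perm (residue_shift (n + d).+1 c.1
    (class_shift c r + quotient_sum n.+1 c.2 (class_shift c r))).
  by rewrite -ltzD1 -PoszD addn1 ltz_pmod.
- move=> i; have [s ->] := decreasing_sort_perm (residue_shift n.+1 c.2 (class_shift c r)).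
  by rewrite -ltzD1 -PoszD addn1 ltz_pmod.
- move=> k; have [s ->] := decreasing_sort_perm (residue_shift (n + d).+1 c.1
    (class_shift c r + quotient_sum n.+1 c.2 (class_shift c r))).
  by rewrite modz_ge0.
- move=> i; have [s ->] := decreasing_sort_perm (residue_shift n.+1 c.2 (class_shift c r)).
  by rewrite modz_ge0.
Qed.

Lemma class_config_equiv n d (c : config n d) r :
  toppling_perm_equiv c (class_config c r).
Proof.
have [_ qs nn] := class_config_qs c r.
apply/toppling_perm_equiv_shiftP => //.
set q := class_shift c r.
exists (q + quotient_sum n.+1 c.2 q), q; split.
- by have /eqP := class_defect_shift c r; rewrite subr_eq0 => /eqP.
- by rewrite addrC addKr.
- exact: decreasing_sort_perm.
- exact: decreasing_sort_perm.
Qed.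

Lemma class_config_inj n d (c : config n d) : injective (class_config c).
Proof.
move=> r r' eq_rr'; apply: (@class_shift_inj _ _ c); move: eq_rr'.
have /eqP := class_defect_shift c r; have /eqP := class_defect_shift c r'.
rewrite !subr_eq0 /class_config /=.
set q := class_shift c r; set q' := class_shift c r'.
set p := q + _; set p' := q' + _ => /eqP Fp' /eqP Fp [eqK eqI].
have sumK : \sum_i residue_shift (n + d).+1 c.1 p i =
            \sum_i residue_shift (n + d).+1 c.1 p' i.
  by rewrite -decreasing_sort_sum eqK decreasing_sort_sum.
have sumI : \sum_i residue_shift n.+1 c.2 q i = \sum_i residue_shift n.+1 c.2 q' i.
  by rewrite -decreasing_sort_sum eqI decreasing_sort_sum.
have Gq : quotient_sum n.+1 c.2 q = p - q by rewrite /p addrC addKr.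
have Gq' : quotient_sum n.+1 c.2 q' = p' - q' by rewrite /p' addrC addKr.
(* Up to constants the component sums are n p - (n + d + 1) q and (n + d + 1) q - (n + 1) p, which
   add up to - p. *)
suff eq_p : p = p' by rewrite Fp Fp' eq_p.
move: sumK sumI; rewrite !sum_residue_shift -Fp -Fp' Gq Gq'.
rewrite -addSn -[n.+1]addn1 !PoszD.
have -> : n%:Z * p = (n%:Z + 1) * p - p by ring.
have -> : n%:Z * p' = (n%:Z + 1) * p' - p' by ring.
nia.
Qed.

Lemma decreasing_sort_eq m (f : {ffun 'I_m -> int}) (g : 'I_m -> int) (s : {perm 'I_m}) :
  decreasing f -> (forall i, f i = g (s i)) -> decreasing_sort g = f.
Proof.
move=> decf fg; have [t gt] := decreasing_sort_perm g.
apply/ffunP; apply: (@decreasing_perm_eq _ _ _ (s * t^-1)%g) => //.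
  exact: decreasing_sortP.
by move=> i; rewrite fg gt permM permKV.
Qed.

Lemma card_equiv_sorted_qs_nonneg n d (c : config n d) :
  [set u | sorted_qs_nonneg n d u /\ toppling_perm_equiv c u] #= `I_(n.+1).
Proof.
apply: (@card_eq_range _ _ (class_config c)).
- exact: card_ord.
- exact: class_config_inj.
- by move=> r; split; [exact: class_config_qs | exact: class_config_equiv].
move=> u [[[decK decI] qs nn] /(toppling_perm_equiv_shiftP _ qs nn)].
move=> [p [q [Fp Gq [sK uK] [sI uI]]]].
have Ep : q + quotient_sum n.+1 c.2 q = p by rewrite Gq addrC subrK.
have [|r Er] := @class_shift_surj _ _ c q.
  by rewrite /class_defect Ep Fp subrr.
exists r; apply: config_eq; rewrite /class_config Er Ep /=; apply/ffunP.
  exact: decreasing_sort_eq decK uK.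
exact: decreasing_sort_eq decI uI.
Qed.

(** * Dhar's criterion and uniqueness of the recurrent representative *)

(* A configuration burns if Dhar's algorithm never gets stuck: a set of vertices
   avoiding the sink, here the set where [b] is minimal, always contains a vertex
   made unstable by toppling all vertices outside the set. *)
Definition burning n d (g : vertex n d -> int) : Prop :=
  forall b : vertex n d -> int, (exists v, b v < b (sink n d)) ->
  exists v, [/\ v != sink n d, forall w, b v <= b w &
    (deg v)%:Z <= g v + \sum_w (adj v w && (b v < b w))%:Z].

(** Among the minimizers of [b], the first one in the recurrence order works: all vertices toppled
    before it have larger [b], so their grains are counted in the sum. It is not the sink, whose [b]
    is not minimal. *)
Lemma recurrent_burning n d (c : config n d) : recurrent c -> burning (grains c).
Proof.
move=> [_ [f [bijf f0 fP]]] b [v bv].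
have [m _ min_m] := @arg_minP _ _ _ (sink n d) xpredT b isT.
have [f' fK f'K] := bijf.
have [i /eqP bi min_i] :=
  @arg_minnP _ (f' m) (fun i => b (f i) == b m) (@nat_of_ord _)
    (introT eqP (congr1 b (f'K m))).
have ineq0 : i != ord0.
  apply/eqP => i0; move: bi; rewrite i0 f0 => bs.
  by have := min_m v isT; rewrite -bs leNgt bv.
have i_gt0 : (0 < i)%N by rewrite lt0n.
exists (f i); split.
- by rewrite -f0 (bij_eq bijf).
- by move=> w; rewrite bi; exact: min_m.
apply: le_trans (fP i i_gt0) _.
rewrite -[grains _ _]/(grains_at (f i) _) raddfD raddf_sum /= lerD2l.
rewrite [leRHS](reindex f) /=; last by exists f'; move=> ? _.
rewrite big_mkcond; apply: ler_sum => j _.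
case: ifP => // lt_ji.
rewrite /grains_at grains_toppling /topple_entry (bij_eq bijf).
rewrite -val_eqE /= gtn_eqF // /adj eq_sym [is_indep (f j) && _]andbC.
rewrite [b (f i) < _]lt_neqAle bi min_m // andbT.
suff -> : b m != b (f j) by rewrite andbT.
by apply/eqP => /esym/eqP /min_i; rewrite leqNgt lt_ji.
Qed.

Definition vertex_perm n d (sK : {perm 'I_n}) (sI : {perm 'I_d}) (v : vertex n d) :
    vertex n d :=
  match v with
  | None => None
  | Some (inl k) => Some (inl (sK k))
  | Some (inr i) => Some (inr (sI i))
  end.

Lemma vertex_permK n d (sK : {perm 'I_n}) (sI : {perm 'I_d}) :
  cancel (vertex_perm sK sI) (vertex_perm sK^-1%g sI^-1%g).
Proof. by move=> [[k|i]|] //=; rewrite permK. Qed.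

Lemma vertex_permKV n d (sK : {perm 'I_n}) (sI : {perm 'I_d}) :
  cancel (vertex_perm sK^-1%g sI^-1%g) (vertex_perm sK sI).
Proof. by move=> [[k|i]|] //=; rewrite permKV. Qed.

Lemma is_indep_vertex_perm n d (sK : {perm 'I_n}) (sI : {perm 'I_d}) v :
  is_indep (vertex_perm sK sI v) = is_indep v.
Proof. by case: v => [[]|]. Qed.

Lemma grains_perm_config n d (sK : {perm 'I_n}) (sI : {perm 'I_d}) c v :
  v != sink n d -> grains (perm_config sK sI c) v = grains c (vertex_perm sK sI v).
Proof. by case: v => [[k|i]|] //=; rewrite ffunE. Qed.

(** [vertex_perm] is a graph automorphism fixing the sink, so a test function [b] can be transported
    along it. *)
Lemma burning_perm n d (sK : {perm 'I_n}) (sI : {perm 'I_d}) g :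
  burning g -> burning (g \o vertex_perm sK sI).
Proof.
set r := vertex_perm sK sI; pose r' := vertex_perm sK^-1%g sI^-1%g.
have rK : cancel r r' := @vertex_permK _ _ sK sI.
have r'K : cancel r' r := @vertex_permKV _ _ sK sI.
move=> burng b [v bv].
have [|w [ws wmin wdeg]] := burng (b \o r'); first by exists (r v); rewrite /= rK.
exists (r' w); split.
- by rewrite -[sink n d]/(r' (sink n d)) (can_eq r'K).
- by move=> x; rewrite -[x]rK; exact: wmin.
rewrite degE is_indep_vertex_perm -degE (le_trans wdeg) //= r'K lerD2l.
rewrite [leRHS](reindex r'); last by exists r; move=> ? _.
by apply: ler_sum => x _; rewrite /adj (can_eq r'K) !is_indep_vertex_perm.
Qed.

(** Otherwise burning with [b := a] gives a minimizer [w] of [a] that one grain from each neighbour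
    of larger [a] makes unstable. Passing to [g'], each such neighbour sends at least one grain and
    the others none, so [g'] is unstable at [w]. *)
Lemma burning_topplings_sink_min n d (g g' a : vertex n d -> int) :
  burning g ->
  (forall v : vertex n d, v != sink n d -> g' v = g v + \sum_w (adj v w)%:Z * (a w - a v)) ->
  (forall v : vertex n d, v != sink n d -> g' v < (deg v)%:Z) ->
  forall v, a (sink n d) <= a v.
Proof.
move=> burng g'E g'deg v; rewrite leNgt; apply/negP => av.
have [|w [ws wmin wdeg]] := burng a; first by exists v.
have := lt_le_trans (g'deg w ws) wdeg; rewrite g'E // ltrD2l; apply/negP.
rewrite -leNgt; apply: ler_sum => x _.
have := wmin x; case: adj => /=; last by rewrite mul0r.
by case: (ltP (a w) (a x)) => /=; lia.
Qed.

Lemma sorted_recurrent_equiv_eq n d (c u : config n d) :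
  sorted_recurrent n d c -> sorted_recurrent n d u -> toppling_perm_equiv c u -> u = c.
Proof.
move=> [[decK decI] recc] [[decK' decI'] recu] [sK [sI [a uE]]].
have [[_ cdeg] _] := recc; have [[_ udeg] _] := recu.
pose r := vertex_perm sK sI; pose s := sink n d.
have rs v : v != s -> r v != s by case: v => [[]|].
have rdeg v : deg (r v) = deg v by rewrite !degE is_indep_vertex_perm.
have gE v : v != s ->
    grains u v = grains c (r v) + \sum_w (adj v w)%:Z * (a w - a v).
  move=> vs; rewrite uE -[LHS]/(grains_at v _) raddfD /= -grains_toppling_sum_adj.
  by rewrite /grains_at grains_perm_config.
have amin : forall v, a s <= a v.
  apply: (burning_topplings_sink_min (burning_perm sK sI (recurrent_burning recc)) gE).
  by move=> v; exact: udeg.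
(* Going back from [u] to the permuted [c] uses the opposite coefficients, which turns the lower
   bound into an upper one. *)
have amax : forall v, - a s <= - a v.
  apply: (@burning_topplings_sink_min _ _ (grains u) (grains c \o r) (fun v => - a v)).
  - exact: recurrent_burning.
  - move=> v vs; rewrite gE //= -addrA -big_split /= big1 ?addr0 // => w _; ring.
  - by move=> v vs; rewrite /= -rdeg; exact: cdeg (rs _ vs).
have ac v : a v = a s by have := amin v; have := amax v; lia.
have {}gE v : v != s -> grains u v = grains c (r v).
  by move=> /gE->; rewrite big1 ?addr0 // => w _; rewrite !ac subrr mulr0.
(* Constant coefficients leave only the permutations, and sorted rearrangements of each other
   coincide. *)
apply/esym/config_eq.
  by apply: (@decreasing_perm_eq _ _ _ sK) => // k; exact: (gE (clique d k)).
by apply: (@decreasing_perm_eq _ _ _ sI) => // i; exact: (gE (indep n i)).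
Qed.

Lemma toppling_perm_equiv_refl n d (c : config n d) : toppling_perm_equiv c c.
Proof.
exists 1%g, 1%g, (fun=> 0); rewrite big1 ?addr0 => [|v _]; last by rewrite mulr0z.
by apply: config_eq => i /=; rewrite ffunE perm1.
Qed.

Lemma sorted_recurrent_qs n d (c : config n d) :
  sorted_recurrent n d c -> sorted_qs_nonneg n d c.
Proof.
move=> [sc [[nc cdeg] _]]; split=> //; split=> [k|i].
  (* Stability bounds a clique entry strictly by [n + d], whereas quasi-stability allows equality;
     at independent vertices the two bounds agree. *)
  by have := cdeg (clique d k) isT; rewrite degE => /ltW.
by have := cdeg (indep n i) isT; rewrite degE /= -ltzD1 -PoszD addn1.
Qed.

Theorem theorem5p1 (n d : nat) (n_gt0 : (0 < n)%N) :
  sorted_qs_nonneg n d #= `I_('C(2 * n + d, n) * 'C(n + d, n)) /\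
  forall c : config n d, sorted_recurrent n d c ->
    let E := [set u | sorted_qs_nonneg n d u /\ toppling_perm_equiv c u] in
    E #= `I_(n.+1) /\ E `&` sorted_recurrent n d = [set c].
Proof.
split=> [|c recc E]; first exact: card_sorted_qs_nonneg.
split; first exact: card_equiv_sorted_qs_nonneg.
apply/seteqP; split=> [u [[_ cu] recu]|u ->].
  exact: sorted_recurrent_equiv_eq recc recu cu.
split=> //; split; [exact: sorted_recurrent_qs | exact: toppling_perm_equiv_refl].
Qed.
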